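(* Let $G=(V,E)$ be a finite simple undirected graph with adjacency matrix $W$, and consider the coordination game on $G$ with strategy set $C=\{1,\dots,m\}$ and payoff matrix $I_m$. Then for every strategy profile $u:V\to C$, \[ E(\Phi u)=2|E|-2\,\mathcal{W}(u), \] and therefore $u\mapsto-\tfrac12E(\Phi u)$ is an exact potential function for the coordination game.
   Context: The payoff to player $v\in V$ for playing $i\in C$ against the profile $u$ is $w_v(i|u)=\sum_{x\in V}W_{v,x}\,\delta(i,u_x)$, with $\delta$ the Kronecker delta. $\mathcal{W}(u)=\frac12\sum_{v\in V}w_v(u_v|u)$. $\Phi u$ is the partition of $V$ in which two vertices are in the same part iff they use the same strategy in $u$. For a partition $P$ of $V$, the min-cut objective is $E(P)=\sum_{(v,x)\in V\times V}W_{v,x}\,(1-\delta_P(v,x))$, where $\delta_P(v,x)=1$ if $v,x$ lie in the same part of $P$ and $0$ otherwise (sum over ordered pairs); $|E|$ is the number of edges of $G$. A function $F:C^V\to\mathbb{R}$ is an exact potential function if for every player $v$, all $r,s\in C$, and every assignment $u_{-v}$ of strategies to the other players, $F(r,u_{-v})-F(s,u_{-v})=w_v(r|u_{-v})-w_v(s|u_{-v})$, where $(r,u_{-v})$ is the profile in which $v$ plays $r$ and the others play $u_{-v}$ (since $G$ has no loops, $w_v(\cdot|u)$ depends only on $u_{-v}$). *)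

(* Defs.v *)
From HB Require Import structures.
From mathcomp Require Import all_boot all_order all_algebra.
From mathcomp Require Import reals.

Set Implicit Arguments.
Unset Strict Implicit.
Unset Printing Implicit Defensive.

Import Order.TTheory GRing.Theory Num.Theory.
Local Open Scope ring_scope.

Section Graph.
Variables (R : realType) (V : finType) (e : rel V).

Definition edges : {set {set V}} := [set [set x; y] | x in V, y in V & e x y].

(* Adjacency matrix, with rows and columns indexed by the vertices. *)
Definition adjacency (v x : V) : R := (e v x)%:R.

End Graph.

Section CoordinationGame.
Variables (R : realType) (V : finType) (m : nat).

(* The strategies 1, ..., m are represented by 'I_m = {0, ..., m-1}. *)
Definition profile := {ffun V -> 'I_m}.

Variable W : V -> V -> R.

(* w_v(i | u) for the payoff matrix I_m, whose (i, j) entry is the Kronecker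
   delta of i and j. *)
Definition payoff (v : V) (i : 'I_m) (u : profile) : R :=
  \sum_(x : V) W v x * (1%:M : 'M[R]_m) i (u x).

Definition welfare (u : profile) : R :=
  2^-1 * \sum_(v : V) payoff v (u v) u.

(* The partition Phi u. *)
Definition strategy_partition (u : profile) : {set {set V}} :=
  preim_partition u [set: V].

Definition same_part (P : {set {set V}}) (v x : V) : bool :=
  [exists B in P, (v \in B) && (x \in B)].

(* Each edge contributes twice, since the sum is over ordered pairs. *)
Definition mincut_objective (P : {set {set V}}) : R :=
  \sum_(p : V * V) W p.1 p.2 * (1 - (same_part P p.1 p.2)%:R).

End CoordinationGame.

Section ExactPotential.
Variables (R : realType) (V : finType) (m : nat).

(* The profile (r, u_{-v}). *)
Definition deviate (u : profile V m) (v : V) (r : 'I_m) : profile V m :=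
  [ffun x => if x == v then r else u x].

(* u_{-v} is given by an arbitrary profile u extending it; the value u v is
   irrelevant to [deviate u v], and to [payoff W v] when W v v = 0. *)
Definition exact_potential (w : V -> 'I_m -> profile V m -> R)
    (F : profile V m -> R) : Prop :=
  forall (v : V) (r s : 'I_m) (u : profile V m),
    F (deviate u v r) - F (deviate u v s) = w v r u - w v s u.

End ExactPotential.

(* Main.v *)
(* The min-cut objective is the total weight of W minus twice the welfare, and
   the total weight of an adjacency matrix is 2|E|.  Since W is symmetric, the
   edges at v enter twice in the sum of all payoffs: once in the payoff of v and
   once in those of its neighbours.  The factor 1/2 in the welfare undoes this,
   so a deviation of v changes the welfare by exactly the change in its own
   payoff. *)

Require Import Defs.
From mathcomp Require Import all_boot all_order all_algebra.
From mathcomp Require Import reals.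
From mathcomp Require Import ring.

Import Order.TTheory GRing.Theory Num.Theory.
Local Open Scope ring_scope.

Lemma same_part_strategy_partition {V : finType} {m : nat} (u : profile V m)
    (v x : V) :
  same_part (strategy_partition u) v x = (u v == u x).
Proof.
have eqR : {in [set: V] & &, equivalence_rel [rel y z | u y == u z]}.
  by split=> //= /eqP->.
have /and3P[/eqP covP triP _] := preim_partitionP u [set: V].
(* Turns [u v == u x] into membership of [x] in the block of [v], the only block that can witness
   [same_part]. *)
have /= <- := pblock_equivalence_partition eqR (in_setT v) (in_setT x).
apply/exists_inP/idP => [[B PB /andP[vB xB]]|xv].
  by rewrite (def_pblock triP PB vB).
exists (pblock (strategy_partition u) v); first by rewrite pblock_mem ?covP.
by rewrite mem_pblock covP in_setT.
Qed.

(** Ordered adjacent pairs are grouped by the edge they span. Each edge arises from exactly its two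
    orientations, which are distinct because there are no loops. *)
Lemma handshake {V : finType} (e : rel V) :
  symmetric e -> irreflexive e ->
  (\sum_(p : V * V) e p.1 p.2 = 2 * #|edges e|)%N.
Proof.
move=> e_sym e_irr; rewrite -big_mkcond /=.
rewrite (partition_big (fun p : V * V => [set p.1; p.2]) (mem (edges e))) /=;
  last first.
  by move=> [v x] /= evx; apply/imset2P; exists v x; rewrite ?inE.
rewrite mulnC -sum_nat_const; apply: eq_bigr => B /imset2P[v x _].
rewrite !inE /= => evx ->.
have v_neq_x : v != x by apply: contraTneq evx => ->; rewrite e_irr.
rewrite sum1_card -[RHS](_ : #|[set (v, x); (x, v)]| = 2); last first.
  by rewrite cards2 xpair_eqE (negPf v_neq_x).
apply: eq_card => -[y z]; rewrite !inE !xpair_eqE unfold_in /=.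
apply/andP/orP => [[eyz /eqP yz_vx]|[] /andP[/eqP-> /eqP->]]; last first.
- by rewrite e_sym evx setUC.
- by rewrite evx.
have: y \in [set v; x] by rewrite -yz_vx set21.
have: z \in [set v; x] by rewrite -yz_vx set22.
(* Of the four cases, the two with [y = z] would be loops; the other two are the orientations. *)
rewrite !inE => /orP[]/eqP zE /orP[]/eqP yE; move: eyz;
  rewrite yE zE ?e_irr ?eqxx// => _; [by right | by left].
Qed.

Lemma payoffE {R : realType} {V : finType} {m : nat} (W : V -> V -> R) (v : V)
    (i : 'I_m) (u : profile V m) :
  payoff W v i u = \sum_(x : V) W v x * (i == u x)%:R.
Proof. by apply: eq_bigr => x _; rewrite mxE. Qed.

Lemma mincut_objective_welfare {R : realType} {V : finType} {m : nat}
    (W : V -> V -> R) (u : profile V m) :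
  mincut_objective W (strategy_partition u)
  = \sum_(p : V * V) W p.1 p.2 - 2 * welfare W u.
Proof.
rewrite /welfare mulrA divff ?pnatr_eq0// mul1r.
under [\sum_v payoff _ _ _ _]eq_bigr do rewrite payoffE.
rewrite (pair_bigA _ (fun v x => W v x * (u v == u x)%:R)) -sumrB.
apply: eq_bigr => p _.
by rewrite same_part_strategy_partition mulrBr mulr1.
Qed.

(** The double sum runs over pairs avoiding [v] and is free of [r], so it cancels when two
    deviations of [v] are compared. *)
Lemma welfare_deviate {R : realType} {V : finType} {m : nat}
    (W : V -> V -> R) (u : profile V m) (v : V) (r : 'I_m) :
  (forall y x, W y x = W x y) -> W v v = 0 ->
  welfare W (deviate u v r) = payoff W v r u
    + 2^-1 * \sum_(y | y != v) \sum_(x | x != v) W y x * (u y == u x)%:R.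
Proof.
move=> W_sym Wvv; rewrite /welfare (bigD1 v)//= !payoffE !ffunE eqxx.
(* The deviation alters only the strategy of [v], which enters with weight [W v v = 0]. *)
have -> : \sum_x W v x * (r == deviate u v r x)%:R
    = \sum_x W v x * (r == u x)%:R.
  apply: eq_bigr => x _; rewrite ffunE.
  by case: (x =P v) => // ->; rewrite Wvv !mul0r.
(* By symmetry, the terms [x = v] in the other players' payoffs add up to a second copy of the
   payoff of [v]. *)
have -> : \sum_(y | y != v) payoff W y (deviate u v r y) (deviate u v r)
    = \sum_x W v x * (r == u x)%:R
      + \sum_(y | y != v) \sum_(x | x != v) W y x * (u y == u x)%:R.
  rewrite [in RHS](bigD1 v)//= Wvv mul0r add0r -big_split /=.
  apply: eq_bigr => y y_neq_v.
  rewrite payoffE (bigD1 v)//= !ffunE eqxx (negPf y_neq_v) W_sym eq_sym.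
  by congr (_ + _); apply: eq_bigr => x /negPf x_neq_v; rewrite ffunE x_neq_v.
by field.
Qed.

Theorem corollary2p1 (R : realType) (V : finType) (e : rel V)
    (e_sym : symmetric e) (e_irr : irreflexive e) (m : nat) :
  let W : V -> V -> R := adjacency R e in
  (forall u : profile V m,
      mincut_objective W (strategy_partition u)
      = 2 * #|edges e|%:R - 2 * welfare W u) /\
  exact_potential (payoff W)
    (fun u : profile V m => - 2^-1 * mincut_objective W (strategy_partition u)).
Proof.
move=> W; split=> [u|v r s u].
  by rewrite mincut_objective_welfare -natrM -handshake// natr_sum.
have W_sym y x : W y x = W x y by rewrite /W /adjacency e_sym.
have Wvv : W v v = 0 by rewrite /W /adjacency e_irr.
by rewrite !mincut_objective_welfare !welfare_deviate//; field.
Qed.
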